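(* Let $H$ be a finite simple graph with $e(H)\ge 2$ edges, and put $p=e(H)$. Let $U\subset[0,1]\times\mathbb{R}$ be the $U$-shaped region associated with this $p$, as defined in the context. Then for every $\epsilon\in[0,1]$ and every $\beta_2\ge 0$ such that $(\epsilon,2\beta_2)\notin U$, the optimizing graphon of the variational problem $$\psi(\epsilon,\beta_2)=\sup\left\{\beta_2 t(H,h)-\frac12\iint_{[0,1]^2}I(h(x,y))\,dx\,dy\;:\;h\text{ a graphon},\ \iint_{[0,1]^2}h(x,y)\,dx\,dy=\epsilon\right\}$$ is uniform.
   Context: A graphon is a measurable function $h:[0,1]^2\to[0,1]$ with $h(x,y)=h(y,x)$. $I(x)=x\log x+(1-x)\log(1-x)$ on $[0,1]$, with $0\log 0=0$. For a finite simple graph $H$ with vertex set $\{1,\dots,v(H)\}$, edge set $E(H)$ and $e(H)=|E(H)|$, put $t(H,h)=\int_{[0,1]^{v(H)}}\prod_{\{i,j\}\in E(H)}h(x_i,x_j)\,dx_1\cdots dx_{v(H)}$. An optimizing graphon is a graphon with $\iint h=\epsilon$ attaining the supremum in the definition of $\psi(\epsilon,\beta_2)$. ''The optimizing graphon is uniform'' means that every optimizing graphon is a.e. constant (hence a.e. equal to $\epsilon$). The $U$-shaped region for an integer $p\ge2$: put $b_c=\frac{p^{p-1}}{(p-1)^p}$. For each real $b>b_c$ there is a unique $a\in\mathbb{R}$ such that the function $\ell(x)=ax+bx^p-x\log x-(1-x)\log(1-x)$ on $[0,1]$ has two distinct global maximizers; denote them $0<x_1(b)<x_2(b)<1$. Then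 $U=\{(\epsilon,b): b>b_c,\ x_1(b)<\epsilon<x_2(b)\}$. *)

(* Defs.v *)
From HB Require Import structures.
From mathcomp Require Import all_boot all_order all_algebra.
From mathcomp Require Import all_classical all_reals all_analysis.

Set Implicit Arguments.
Unset Strict Implicit.
Unset Printing Implicit Defensive.

Import Order.TTheory GRing.Theory Num.Theory.
Import numFieldNormedType.Exports.

Local Open Scope classical_set_scope.
Local Open Scope ring_scope.

(* The library has no product measure on tuples; it is built by recursion on
   the size, transporting the binary product [lebesgue_measure \x _] along
   [tuple_cons]. *)
Section tuple_cons_measure.
Variables (R : realType) (n : nat).
Local Notation mR := (measurableTypeR R).

Definition tuple_cons (z : mR * n.-tuple mR) : n.+1.-tuple mR :=
  [the n.+1.-tuple mR of z.1 :: z.2].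

Lemma measurable_tuple_cons : measurable_fun [set: mR * n.-tuple mR] tuple_cons.
Proof. by apply: measurable_cons. Qed.

Variable mu : {sigma_finite_measure set (n.-tuple mR) -> \bar R}.

Definition tuple_cons_measure : set (n.+1.-tuple mR) -> \bar R :=
  pushforward (lebesgue_measure \x mu)%E tuple_cons.

Let preimage_measurable A : measurable A -> measurable (tuple_cons @^-1` A).
Proof.
by move=> mA; rewrite -[X in measurable X]setTI; exact: measurable_tuple_cons.
Qed.

Let tuple_cons_measure0 : tuple_cons_measure set0 = 0%E.
Proof. by rewrite /tuple_cons_measure /pushforward preimage_set0 measure0. Qed.

Let tuple_cons_measure_ge0 A : (0 <= tuple_cons_measure A)%E.
Proof. by rewrite /tuple_cons_measure /pushforward measure_ge0. Qed.

Let tuple_cons_measure_sigma_additive : semi_sigma_additive tuple_cons_measure.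
Proof.
move=> F mF tF mUF; rewrite /tuple_cons_measure /pushforward preimage_bigcup.
apply: measure_semi_sigma_additive.
- by move=> i; exact: preimage_measurable.
- apply/trivIsetP => i j _ _ ij; rewrite -preimage_setI.
  by move/trivIsetP : tF => /(_ _ _ _ _ ij) ->//; rewrite preimage_set0.
- by rewrite -preimage_bigcup; exact: preimage_measurable.
Qed.

HB.instance Definition _ := isMeasure.Build _ _ _ tuple_cons_measure
  tuple_cons_measure0 tuple_cons_measure_ge0 tuple_cons_measure_sigma_additive.

Let tuple_cons_measure_sigma_finite : sigma_finite setT tuple_cons_measure.
Proof.
have /sigma_finiteP[F [FT ndF Foo]] := sigma_finiteT (@lebesgue_measure R).
have /sigma_finiteP[G [GT ndG Goo]] := sigma_finiteT mu.
pose g (u : n.+1.-tuple mR) : mR * n.-tuple mR := (thead u, [tuple of behead u]).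
have mg : measurable_fun setT g.
  apply/measurable_fun_pair; first exact: measurable_tnth.
  exact: measurable_behead.
have gK : cancel tuple_cons g.
  by move=> [x u]; congr pair; apply: val_inj.
exists (fun i => g @^-1` (F i `*` G i)).
  rewrite -preimage_bigcup (_ : \bigcup_i _ = setT) ?preimage_setT//.
  rewrite -subTset => -[x u] _.
  have [k _ Fkx] : (\bigcup_i F i) x by rewrite -FT.
  have [l _ Glu] : (\bigcup_i G i) u by rewrite -GT.
  exists (maxn k l) => //; split => /=.
  - by move: x Fkx; exact/subsetPset/ndF/leq_maxl.
  - by move: u Glu; exact/subsetPset/ndG/leq_maxr.
move=> i; have [mF Fioo] := Foo i; have [mG Gioo] := Goo i; split.
  by rewrite -[X in measurable X]setTI; apply: mg => //; exact: measurableX.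
rewrite /tuple_cons_measure /pushforward (_ : _ @^-1` _ = F i `*` G i).
  by rewrite product_measure1E// lte_mul_pinfty// ge0_fin_numE.
by apply/funext => z; exact: (congr1 (F i `*` G i) (gK z)).
Qed.

HB.instance Definition _ := Measure_isSigmaFinite.Build _ _ _ tuple_cons_measure
  tuple_cons_measure_sigma_finite.

End tuple_cons_measure.

Fixpoint lebesgue_tuple (R : realType) (n : nat) :
    {sigma_finite_measure set (n.-tuple (measurableTypeR R)) -> \bar R} :=
  match n with
  | 0 => dirac [tuple]
  | m.+1 => tuple_cons_measure (lebesgue_tuple R m)
  end.

Section graphons.
Context {R : realType}.
Local Notation mR := (measurableTypeR R).
Implicit Types (h : mR * mR -> R) (x eps b beta : R).

Definition unit_square : set (mR * mR) := `[0, 1]%classic `*` `[0, 1]%classic.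

Definition unit_cube (n : nat) : set (n.-tuple mR) :=
  [set u | forall i, tnth u i \in `[0, 1]].

Definition lebesgue2 : {measure set (mR * mR) -> \bar R} :=
  (@lebesgue_measure R \x @lebesgue_measure R)%E.

(* Graphons live on the unit square; their values elsewhere are irrelevant. *)
Definition graphon h : Prop :=
  [/\ measurable_fun unit_square h,
      forall z, unit_square z -> 0 <= h z <= 1 &
      forall x y, unit_square (x, y) -> h (x, y) = h (y, x)].

(* As [ln 0 = 0], this respects the convention [0 log 0 = 0]. *)
Definition I_fun x : R := x * ln x + (1 - x) * ln (1 - x).

(* Each undirected edge {i, j} is represented by the pair (i, j) with i < j. *)
Definition edges (n : nat) (H : rel 'I_n) : {set 'I_n * 'I_n} :=
  [set ij : 'I_n * 'I_n | (ij.1 < ij.2)%N && H ij.1 ij.2]%SET.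

Definition hom_density (n : nat) (H : rel 'I_n) h : R :=
  \int[lebesgue_tuple R n]_(x in @unit_cube n)
    \prod_(ij in edges H) h (tnth x ij.1, tnth x ij.2).

Definition feasible eps : set (mR * mR -> R) :=
  [set h | graphon h /\ \int[lebesgue2]_(z in unit_square) h z = eps].

Definition objective (n : nat) (H : rel 'I_n) beta h : R :=
  beta * hom_density H h - 2^-1 * \int[lebesgue2]_(z in unit_square) I_fun (h z).

Definition psi (n : nat) (H : rel 'I_n) eps beta : \bar R :=
  ereal_sup [set (objective H beta h)%:E | h in feasible eps].

Definition optimizing (n : nat) (H : rel 'I_n) eps beta h : Prop :=
  feasible eps h /\ (objective H beta h)%:E = psi H eps beta.

Definition uniform h : Prop :=
  exists c, {ae lebesgue2, forall z, unit_square z -> h z = c}.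

Definition ell (p : nat) (a b x : R) : R :=
  a * x + b * x ^+ p - x * ln x - (1 - x) * ln (1 - x).

Definition maximizers (p : nat) (a b : R) : set R :=
  [set x | x \in `[0, 1] /\ forall y, y \in `[0, 1] -> ell p a b y <= ell p a b x].

Definition b_c (p : nat) : R := p%:R ^+ p.-1 / (p%:R - 1) ^+ p.

(* For b > b_c the parameter [a] below exists and is unique, so this is the
   region between the two maximizers x1(b) < x2(b). *)
Definition U_region (p : nat) : set (R * R) :=
  [set eb | b_c p < eb.2 /\
     exists a x1 x2 : R,
       [/\ 0 < x1, x1 < x2, x2 < 1,
           maximizers p a eb.2 = [set x1; x2] &
           x1 < eb.1 < x2]].

End graphons.

(* Main.v *)
Require Import Defs.
From mathcomp Require Import all_boot all_order all_algebra.
From mathcomp Require Import all_classical all_reals all_analysis.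
From mathcomp Require Import measurable_realfun ring lra.
Import Order.TTheory GRing.Theory Num.Theory.
Import numFieldNormedType.Exports.

Local Open Scope classical_set_scope.
Local Open Scope ring_scope.
Set Implicit Arguments.
Unset Strict Implicit.
Unset Printing Implicit Defensive.

(* AM-GM on the edge factors gives [t(H, h) <= \int h^p], so twice the objective
   is at most [\int g(h)] with [g x = b x^p - I x], [b = 2 beta2], with equality
   for constant [h].  It then suffices to find [a] such that [eps] maximizes
   [ell x = a x + g x] on [0, 1] and all other maximizers are on one side of
   [eps]: an optimizer [h] has [\int ell(h) >= ell(eps)], so its values are
   a.e. maximizers, and having mean [eps] it is a.e. equal to [eps].
   The intermediate value theorem gives an [a] for which the maxima of [ell] over
   [0, eps] and [eps, 1] agree.  By Rolle, [ell] has at most two maximizers, and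
   two only if [b > b_c], because [ell'' = 0] means
   [b p (p-1) x^(p-1) (1-x) = 1].  So if [eps] were not a maximizer, the two
   maximizers would enclose it and [(eps, b)] would lie in [U]. *)

(** * Calculus of [ell] on [0, 1] *)

Section ell_maximizers.
Context {R : realType}.
Implicit Types (a b x y eps : R) (k p : nat).

(** With s the square root of x, |x ln x| is 2 s times s ln (1/s), and ln (1/s) <= 1/s bounds the
    second factor by 1. For x <= 0 the left side vanishes because [ln] does. This is the squeeze
    needed at 0. *)
Lemma normr_xlnx_le x : x <= 1 -> `|x * ln x| <= 2 * Num.sqrt x.
Proof.
have [x0 _|x0 x1] := leP x 0.
  by rewrite ln0// mulr0 normr0 mulr_ge0// sqrtr_ge0.
have s0 : 0 < Num.sqrt x by rewrite sqrtr_gt0.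
rewrite ler0_norm ?mulr_ge0_le0 ?ln_le0 ?(ltW x0)//.
rewrite -{1 2}(sqr_sqrtr (ltW x0)) lnXn// -mulrN -mulNrn -lnV ?posrE//.
have si0 : 0 < (Num.sqrt x)^-1 by rewrite invr_gt0.
have := ltW (ln_sublinear si0); set l := ln _ => hl.
have -> : Num.sqrt x ^+ 2 * (l *+ 2) = 2 * Num.sqrt x * (Num.sqrt x * l) by ring.
rewrite -[leRHS]mulr1 ler_pM2l ?mulr_gt0//.
by rewrite -(mulfV (lt0r_neq0 s0)) ler_pM2l.
Qed.

(** The convention that [ln] is 0 on nonpositive reals makes x ln x continuous on the whole line, so
    no later continuity argument has to be restricted to [0, 1]. *)
Lemma continuous_xlnx : continuous (fun x => x * ln x).
Proof.
move=> x; have [x0|x0|->] := ltgtP x 0.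
- rewrite /continuous_at ln0 ?ltW// mulr0.
  apply: cvg_near_cst; near=> y; apply/eqP.
  rewrite ln0 ?mulr0 ?ltW//; near: y; exact: lt_nbhsl.
- by apply: cvgM; [exact: cvg_id|exact: continuous_ln].
- rewrite /continuous_at mul0r.
  have sq : (2 * Num.sqrt y) @[y --> (0 : R)] --> (0 : R).
    rewrite -[X in _ --> X](mulr0 2); apply: cvgMr.
    by rewrite -[X in _ --> X]sqrtr0; exact: sqrt_continuous.
  apply/norm_cvg0P.
  apply: (squeeze_cvgr _ (cvg_cst (0 : R)) sq).
  near=> y; rewrite normr_ge0/= normr_xlnx_le// ltW//.
  by near: y; exact: lt_nbhsl.
Unshelve. all: by end_near. Qed.

Lemma continuous_ell p a b : continuous (ell p a b).
Proof.
move=> x; apply: cvgB; last first.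
  have h : (1 - y) @[y --> x] --> 1 - x.
    by apply: cvgB; [exact: cvg_cst|exact: cvg_id].
  exact: (cvg_comp _ _ h (@continuous_xlnx (1 - x))).
apply: cvgB; last exact: continuous_xlnx.
apply: cvgD; apply: cvgMr; first exact: cvg_id.
exact: exprn_continuous.
Qed.

Lemma ell_shift p a a' b x : ell p a b x = ell p a' b x + (a - a') * x.
Proof. by rewrite /ell; ring. Qed.

(** [ell1] and [ell2] are the first two derivatives of [ell p a b] on (0, 1). The second no longer
    depends on [a], so the inflection points are controlled by [b] alone. *)
Definition ell1 p a b x := a + b * (p%:R * x ^+ p.-1) - ln x + ln (1 - x).

Definition ell2 p b x :=
  b * (p%:R * (p.-1%:R * x ^+ p.-2)) - x^-1 - (1 - x)^-1.

Lemma is_derive_ln1B x : x < 1 ->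
  is_derive x 1 (fun y => ln (1 - y)) (- (1 - x)^-1).
Proof.
move=> x1; rewrite -mulrN1.
apply: (@is_derive1_comp _ (@ln R) (fun y => 1 - y)).
  by apply: is_derive1_ln; rewrite subr_gt0.
by apply: is_derive_eq; rewrite add0r mul1r.
Qed.

Lemma is_derive_ell p a b x : 0 < x < 1 ->
  is_derive x 1 (ell p a b) (ell1 p a b x).
Proof.
case/andP=> x0 x1.
have hl := is_derive1_ln x0.
have hm := is_derive_ln1B x1.
pose l1 : R -> R := fun y => ln (1 - y).
rewrite (_ : ell p a b = cst a * (@id R) + cst b * (@id R) ^+ p -
  (@id R) * (@ln R) - (cst 1 - (@id R)) * l1); last first.
  by apply/funext => y; rewrite /ell !fctE.
apply: is_derive_eq.
rewrite /ell1 /GRing.scale/= /l1 !fctE.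
have x1' : 1 - x != 0 by rewrite subr_eq0 gt_eqF.
have x0' : x != 0 by rewrite gt_eqF.
by field; rewrite x0' x1'.
Qed.

Lemma is_derive_ell1 p a b x : 0 < x < 1 ->
  is_derive x 1 (ell1 p a b) (ell2 p b x).
Proof.
case/andP=> x0 x1.
have hl := is_derive1_ln x0.
have hm := is_derive_ln1B x1.
pose l1 : R -> R := fun y => ln (1 - y).
rewrite (_ : ell1 p a b = cst a + cst b * (cst p%:R * (@id R) ^+ p.-1) -
  (@ln R) + l1); last by apply/funext => y; rewrite /ell1 !fctE.
apply: is_derive_eq.
rewrite /ell2 /GRing.scale/= !fctE.
ring.
Qed.

(** Rolle's theorem for an explicitly given derivative. *)
Lemma is_derive_root_between (f df : R -> R) x y : x < y ->
  (forall z, x <= z <= y -> is_derive z 1 f (df z)) -> f x = f y ->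
  exists2 z, x < z < y & df z = 0.
Proof.
move=> xy fdf fxy.
have [||z zxy] := @MVT R f df x y xy.
- by move=> z; rewrite in_itv/= => /andP[/ltW xz /ltW zy]; apply: fdf; rewrite xz.
- apply: derivable_within_continuous => z; rewrite in_itv/= => zxy.
  by have [] := fdf z zxy.
rewrite fxy subrr => /esym/eqP; rewrite mulf_eq0 subr_eq0 (gt_eqF xy) orbF.
by move/eqP => dz; exists z => //; move: zxy; rewrite in_itv.
Qed.

(** With p = k + 2, multiplying ell'' by x (1 - x) gives b p (p - 1) x^(p-1) (1 - x) - 1, so the
    zeros of ell'' in (0, 1) lie on one level set of [hump k]. The factored derivative [dhump] shows
    that its only positive critical point is (p - 1) / p. *)
Definition hump k x : R := x ^+ k.+1 * (1 - x).

Definition dhump k x : R := x ^+ k * (k.+1%:R - k.+2%:R * x).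

Lemma is_derive_hump k x : is_derive x 1 (hump k) (dhump k x).
Proof.
rewrite (_ : hump k = (@id R) ^+ k.+1 * (cst 1 - (@id R))); last first.
  by apply/funext => y; rewrite /hump !fctE.
apply: is_derive_eq; rewrite /dhump /GRing.scale/= !fctE -[k.+2%:R]natr1 exprS; ring.
Qed.

Lemma dhump_eq0 k x : 0 < x -> dhump k x = 0 -> x = k.+1%:R / k.+2%:R.
Proof.
move=> x0 /eqP; rewrite mulf_eq0 expf_eq0 (gt_eqF x0) andbF/= subr_eq0 => /eqP ->.
by rewrite mulrC mulKf// pnatr_eq0.
Qed.

Lemma ell2_eq0 k b x : 0 < x < 1 -> ell2 k.+2 b x = 0 ->
  b * (k.+2%:R * k.+1%:R) * hump k x = 1.
Proof.
case/andP=> x0 x1.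
have x1' : 1 - x != 0 by rewrite subr_eq0 gt_eqF.
have x0' : x != 0 by rewrite gt_eqF.
move=> e0; rewrite -[RHS]addr0 -(mulr0 (x * (1 - x))) -e0 /ell2 /hump/= exprS.
by field; rewrite x0' x1'.
Qed.

(** This identifies [b_c] as the threshold for inflection points: at b = [b_c] the level set from
    [ell2_eq0] passes through the critical point of the hump. *)
Lemma b_c_hump k :
  @b_c R k.+2 * (k.+2%:R * k.+1%:R) * hump k (k.+1%:R / k.+2%:R) = 1.
Proof.
rewrite /b_c /hump/= -natr1 addrK expr_div_n.
have h1 : k.+1%:R != 0 :> R by rewrite pnatr_eq0.
have h2 : k.+2%:R != 0 :> R by rewrite pnatr_eq0.
move: h1 h2; rewrite -[k.+2%:R]natr1; move: (k.+1%:R : R) => q h1 h2.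
have hq : q ^+ k.+1 != 0 by rewrite expf_eq0 negb_and h1 orbT.
have hr : (q + 1) ^+ k.+1 != 0 by rewrite expf_eq0 negb_and h2 orbT.
rewrite (exprS q k.+1); set u := q ^+ k.+1 in hq *; set v := (_ ^+ k.+1) in hr *.
by field; rewrite h1 h2 hq hr.
Qed.

(** * Location and number of the maximizers *)

Lemma maximizer_gt0 p a b x : (0 < p)%N -> 0 <= b -> maximizers p a b x -> 0 < x.
Proof.
move=> p0 b0 [x01 xmax]; move: x01; rewrite in_itv/= => /andP[x0 x1].
rewrite lt_neqAle x0 andbT; apply/eqP => x0'.
(* Since ln y <= a - 1, the part a y - y ln y is at least y, and the remaining terms of [ell] at y
   are nonnegative. Hence y beats the value 0 taken at the endpoint 0. *)
pose y := Num.min (expR (a - 1)) (2^-1 : R).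
have y0 : 0 < y by rewrite lt_min expR_gt0 invr_gt0 ltr0n.
have y1 : y < 1 by rewrite gt_min invf_lt1 ?ltr1n ?ltr0n ?orbT.
have lny : ln y <= a - 1.
  by rewrite -(expRK (a - 1)) ler_ln ?posrE ?expR_gt0// ge_min lexx.
have := xmax y; rewrite in_itv/= (ltW y0) (ltW y1) => /(_ isT).
rewrite -x0' /ell expr0n (negPf (lt0n_neq0 p0)) subr0 ln1 !(mulr0, mul0r, subr0, addr0).
have ln1y : ln (1 - y) <= 0 by rewrite ln_le0// gerBl ltW.
have h1 : 0 <= b * y ^+ p by rewrite mulr_ge0// exprn_ge0// ltW.
have h2 : (1 - y) * ln (1 - y) <= 0 by rewrite mulr_ge0_le0// subr_ge0 ltW.
have h3 : y * ln y <= y * (a - 1) by rewrite ler_pM2l.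
lra.
Qed.

Lemma exprn_bernoulli (p : nat) (y : R) : 0 <= y <= 1 -> 1 - p%:R * y <= (1 - y) ^+ p.
Proof.
case/andP=> y0 y1; elim: p => [|p IH]; first by rewrite mul0r subr0 expr0.
have : (1 - y) * (1 - p%:R * y) <= (1 - y) ^+ p.+1.
  by rewrite exprS ler_wpM2l// subr_ge0.
have : 0 <= p%:R * (y * y) by rewrite !mulr_ge0.
rewrite -natr1; lra.
Qed.

Lemma maximizer_lt1 p a b x : (0 < p)%N -> 0 <= b -> maximizers p a b x -> x < 1.
Proof.
move=> p0 b0 [x01 xmax]; move: x01; rewrite in_itv/= => /andP[x0 x1].
rewrite lt_neqAle x1 andbT; apply/eqP => x1'.
(* By Bernoulli, the value at 1 - y exceeds the value a + b at 1 by at least y (- a - b p - ln y),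
   and ln y <= c makes this at least y. *)
pose c := - a - b * p%:R - 1.
pose y := Num.min (expR c) (2^-1 : R).
have y0 : 0 < y by rewrite lt_min expR_gt0 invr_gt0 ltr0n.
have y1 : y < 1 by rewrite gt_min invf_lt1 ?ltr1n ?ltr0n ?orbT.
have lny : ln y <= c.
  by rewrite -(expRK c) ler_ln ?posrE ?expR_gt0// ge_min lexx.
have := xmax (1 - y); rewrite in_itv/= subr_ge0 gerBl (ltW y0) (ltW y1) => /(_ isT).
rewrite x1' /ell expr1n subrr ln1 (_ : 1 - (1 - y) = y); last by lra.
have ln1y : ln (1 - y) <= 0 by rewrite ln_le0// gerBl ltW.
have h1 : b * (1 - p%:R * y) <= b * (1 - y) ^+ p.
  by rewrite ler_wpM2l// exprn_bernoulli// !ltW.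
have h2 : (1 - y) * ln (1 - y) <= 0 by rewrite mulr_ge0_le0// subr_ge0 ltW.
have h3 : y * ln y <= y * c by rewrite ler_pM2l.
rewrite /c in h3; lra.
Qed.

Lemma maximizer_ell1 p a b x : (0 < p)%N -> 0 <= b -> maximizers p a b x ->
  ell1 p a b x = 0.
Proof.
move=> p0 b0 mx; have x0 := maximizer_gt0 p0 b0 mx.
have x1 := maximizer_lt1 p0 b0 mx; case: mx => _ xmax.
have d1 : is_derive x 1 (ell p a b) (ell1 p a b x).
  by apply: is_derive_ell; rewrite x0.
have d2 : is_derive x 1 (ell p a b) 0.
  apply: (@derive1_at_max _ (ell p a b) 0 1) => //.
  - by move=> t; rewrite in_itv/= => /(is_derive_ell p a b)[].
  - by rewrite in_itv/= x0.
  - move=> t; rewrite in_itv/= => /andP[t0 t1]; apply: xmax.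
    by rewrite in_itv/= !ltW.
by rewrite -(@derive_val _ _ _ _ _ _ _ d1) (@derive_val _ _ _ _ _ _ _ d2).
Qed.

(** Two maximizers are interior, so ell' vanishes at both. Their values agree, so ell' also vanishes
    at some w between them. Rolle for ell' on each side of w gives the two zeros of ell''. *)
Lemma maximizers_inflection p a b x y : (0 < p)%N -> 0 <= b ->
  maximizers p a b x -> maximizers p a b y -> x < y ->
  exists z1 z2, [/\ x < z1, z1 < z2, z2 < y, ell2 p b z1 = 0 & ell2 p b z2 = 0].
Proof.
move=> p0 b0 mx my xy.
have x0 := maximizer_gt0 p0 b0 mx; have y1 := maximizer_lt1 p0 b0 my.
have exy : ell p a b x = ell p a b y.
  case: mx my => [xI xM] [yI yM]; apply/eqP; rewrite eq_le.
  by rewrite (xM _ yI) (yM _ xI).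
have [|w /andP[xw wy] w0] := is_derive_root_between (df := ell1 p a b) xy _ exy.
  move=> z /andP[xz zy]; apply: is_derive_ell.
  by rewrite (lt_le_trans x0 xz) (le_lt_trans zy y1).
have in01 u v z : x <= u -> v <= y -> u <= z <= v -> 0 < z < 1.
  move=> xu vy /andP[uz zv].
  by rewrite (lt_le_trans x0 (le_trans xu uz)) (le_lt_trans (le_trans zv vy) y1).
have [|z1 /andP[xz1 z1w] z10] := is_derive_root_between (df := ell2 p b) xw _
    (etrans (maximizer_ell1 p0 b0 mx) (esym w0)).
  by move=> z zI; apply: is_derive_ell1; apply: in01 zI => //; exact: ltW.
have [|z2 /andP[wz2 z2y] z20] := is_derive_root_between (df := ell2 p b) wy _
    (etrans w0 (esym (maximizer_ell1 p0 b0 my))).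
  by move=> z zI; apply: is_derive_ell1; apply: in01 zI => //; exact: ltW.
by exists z1, z2; split => //; exact: lt_trans z1w wz2.
Qed.

(** Both zeros lie on the same level of [hump k], so Rolle puts a critical point strictly between
    them, and there is only one candidate. *)
Lemma ell2_roots k b z1 z2 : 0 < z1 -> z1 < z2 -> z2 < 1 ->
  ell2 k.+2 b z1 = 0 -> ell2 k.+2 b z2 = 0 ->
  z1 < k.+1%:R / k.+2%:R < z2.
Proof.
move=> z10 z12 z21 e1 e2.
have z1I : 0 < z1 < 1 by rewrite z10 (lt_trans z12).
have z2I : 0 < z2 < 1 by rewrite z21 (lt_trans z10).
have h1 := ell2_eq0 z1I e1; have h2 := ell2_eq0 z2I e2.
have h : hump k z1 = hump k z2.
  have B0 : b * (k.+2%:R * k.+1%:R) != 0.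
    by apply: contra_eq_neq h1 => ->; rewrite mul0r eq_sym oner_eq0.
  by apply: (mulfI B0); rewrite h1 h2.
have [|w /andP[z1w wz2] w0] := is_derive_root_between (df := dhump k) z12 _ h.
  by move=> z _; exact: is_derive_hump.
by rewrite -(dhump_eq0 (lt_trans z10 z1w) w0) z1w.
Qed.

(** The first inflection point z1 lies left of the peak w of the hump, where the hump is strictly
    lower than at w. The level equation at z1 therefore needs a larger coefficient than the one
    [b_c] provides at w. *)
Lemma maximizers_b_c p a b x y : (2 <= p)%N -> 0 <= b ->
  maximizers p a b x -> maximizers p a b y -> x < y -> b_c p < b.
Proof.
case: p => [|[|k]]// _ b0 mx my xy.
have x0 := maximizer_gt0 (ltn0Sn _) b0 mx; have y1 := maximizer_lt1 (ltn0Sn _) b0 my.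
have [z1 [z2 [xz1 z12 z2y e1 e2]]] := maximizers_inflection (ltn0Sn _) b0 mx my xy.
have z10 := lt_trans x0 xz1; have z21 := lt_trans z2y y1.
have /andP[z1w wz2] := ell2_roots z10 z12 z21 e1 e2.
set w := _ / _ in z1w wz2.
have bw : hump k z1 < hump k w.
  have [||c] := @MVT R (hump k) (dhump k) z1 w z1w.
  - by move=> z _; exact: is_derive_hump.
  - apply: derivable_within_continuous => z _.
    by have [] := is_derive_hump k z.
  rewrite in_itv/= => /andP[z1c cw] hc.
  rewrite -subr_gt0 hc mulr_gt0 ?subr_gt0//.
  rewrite mulr_gt0//; first by rewrite exprn_gt0// (lt_trans z10).
  by rewrite subr_gt0 mulrC -ltr_pdivlMr ?ltr0n.
have z1I : 0 < z1 < 1 by rewrite z10 (lt_trans z12).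
have hb := etrans (ell2_eq0 z1I e1) (esym (b_c_hump k)); rewrite -/w in hb.
have kk : 0 < k.+2%:R * k.+1%:R :> R by rewrite mulr_gt0 ?ltr0n.
have bz1 : 0 < hump k z1.
  by rewrite mulr_gt0 ?exprn_gt0// subr_gt0 (lt_trans z12).
have b_gt0 : 0 < b.
  rewrite lt_neqAle b0 andbT eq_sym; apply/eqP => b00.
  by have /esym/eqP := ell2_eq0 z1I e1; rewrite b00 !mul0r oner_eq0.
(* By [hb] the left side equals the expression of [b_c_hump], so cancelling the common positive
   factors leaves [b_c] < b. *)
have : b * (k.+2%:R * k.+1%:R) * hump k z1 < b * (k.+2%:R * k.+1%:R) * hump k w.
  by rewrite ltr_pM2l// mulr_gt0.
by rewrite hb !ltr_pM2r// (lt_trans bz1).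
Qed.

(** Each consecutive pair of maximizers would enclose the peak (p - 1) / p of the hump, which cannot
    lie both below and above y. *)
Lemma maximizers_no3 p a b x y z : (2 <= p)%N -> 0 <= b ->
  maximizers p a b x -> maximizers p a b y -> maximizers p a b z ->
  x < y -> y < z -> False.
Proof.
case: p => [|[|k]]// _ b0 mx my mz xy yz.
have x0 := maximizer_gt0 (ltn0Sn _) b0 mx; have z1 := maximizer_lt1 (ltn0Sn _) b0 mz.
have y0 := lt_trans x0 xy; have y1 := lt_trans yz z1.
have [u1 [u2 [xu1 u12 u2y e1 e2]]] := maximizers_inflection (ltn0Sn _) b0 mx my xy.
have [v1 [v2 [yv1 v12 v2z f1 f2]]] := maximizers_inflection (ltn0Sn _) b0 my mz yz.
have /andP[_] := ell2_roots (lt_trans x0 xu1) u12 (lt_trans u2y y1) e1 e2.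
have /andP[+ _] := ell2_roots (lt_trans y0 yv1) v12 (lt_trans v2z z1) f1 f2.
move=> h1 h2; have := lt_trans (lt_trans h1 h2) (lt_trans u2y yv1).
by rewrite ltxx.
Qed.

(** * Choice of the linear coefficient [a] *)

Lemma ell_parts_max p a b x y : 0 <= x <= y -> y <= 1 ->
  exists2 c, x <= c <= y & forall t, x <= t <= y -> ell p a b t <= ell p a b c.
Proof.
case/andP=> x0 xy y1.
have [|c] := @EVT_max R (ell p a b) x y xy.
  exact/continuous_subspaceT/continuous_ell.
by rewrite in_itv/= => cI cM; exists c => // t tI; apply: cM; rewrite in_itv.
Qed.

(* The difference of the maxima of [ell p a b] over [0, eps] and [eps, 1] is
   Lipschitz in [a], positive for [a] near -oo and negative for [a] near +oo. *)
Lemma maximizers_straddle p b eps : (0 < p)%N -> 0 <= b -> 0 < eps < 1 ->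
  exists a x y, [/\ maximizers p a b x, maximizers p a b y, x <= eps & eps <= y].
Proof.
move=> p0 b0 /andP[e0 e1].
have [|l lP] := @choice R R (fun a c => 0 <= c <= eps /\
    forall t, 0 <= t <= eps -> ell p a b t <= ell p a b c).
  move=> a; have [||c cI cM] := @ell_parts_max p a b 0 eps; rewrite ?lexx ?ltW//.
  by exists c.
have [|r rP] := @choice R R (fun a c => eps <= c <= 1 /\
    forall t, eps <= t <= 1 -> ell p a b t <= ell p a b c).
  move=> a; have [||c cI cM] := @ell_parts_max p a b eps 1; rewrite ?lexx ?ltW//.
  by exists c.
pose D a := ell p a b (l a) - ell p a b (r a).
(* Replacing a by a' changes [ell] by at most |a' - a| at any point of [0, 1], so each of the two
   maxima moves by at most that much. The bound holds whichever maximizers [l] and [r] select. *)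
have D_lip a a' : D a' <= D a + 2 * `|a' - a|.
  have [/andP[la0 lae] laM] := lP a; have [/andP[l0 le] _] := lP a'.
  have [/andP[rae ra1] _] := rP a; have [/andP[re r1] rM] := rP a'.
  have := laM (l a'); rewrite l0 le => /(_ isT) h1.
  have := rM (r a); rewrite rae ra1 => /(_ isT) h2.
  rewrite /D (ell_shift p a' a).
  rewrite [ell p a' b (r a)](ell_shift p a' a) in h2.
  have n0 := normr_ge0 (a' - a).
  have h3 : (a' - a) * l a' <= `|a' - a|.
    rewrite (le_trans (ler_norm _))// normrM ler_piMr// ger0_norm//.
    by rewrite (le_trans le)// ltW.
  have h4 : - ((a' - a) * r a) <= `|a' - a|.
    rewrite (le_trans (ler_norm _))// normrN normrM ler_piMr// ger0_norm//.
    by rewrite (le_trans _ rae)// ltW.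
  lra.
have D_cont : continuous D.
  move=> a; apply/cvgrPdist_le => e e_gt0; near=> a'.
  have aa' : `|a - a'| <= e / 2.
    by near: a'; apply: cvgr_dist_le; rewrite ?divr_gt0.
  have := D_lip a a'; have := D_lip a' a; rewrite (distrC a') => h1 h2.
  rewrite ler_norml; apply/andP; split; lra.
have [||g /andP[g0 g1] gM] := @ell_parts_max p 0 b 0 1; rewrite ?lexx ?ler01//.
set G := ell p 0 b g in gM.
have ell00 a : ell p a b 0 = 0.
  by rewrite /ell expr0n (negPf (lt0n_neq0 p0)) subr0 ln1 !(mulr0, mul0r, subr0, addr0).
have ell1E a : ell p a b 1 = a + b.
  by rewrite /ell expr1n subrr ln1 !(mulr1, mul0r, mulr0, subr0).
have G0 : 0 <= G by rewrite -(ell00 0); apply: gM; rewrite lexx ler01.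
(* K makes the linear term outweigh the maximum G of [ell] with a = 0. For a = -K, values on
   [eps, 1] are at most G - K eps <= 0, the value at 0. For a = K, values on [0, eps] are at most G
   + K eps <= K, which is at most the value K + b at 1. *)
pose K := G / eps + G / (1 - eps).
have e1' : 0 < 1 - eps by rewrite subr_gt0.
have e0_ge0 := ltW e0; have e1_ge0 := ltW e1'.
have K0 : 0 <= K by rewrite addr_ge0 ?divr_ge0.
have Ke : G <= K * eps.
  by rewrite mulrDl divfK ?gt_eqF// lerDl mulr_ge0 ?divr_ge0.
have Ke' : G <= K * (1 - eps).
  by rewrite mulrDl divfK ?gt_eqF// lerDr mulr_ge0 ?divr_ge0.
have DN : 0 <= D (- K).
  have [_ lM] := lP (- K); have [/andP[re r1] _] := rP (- K).
  have := lM 0; rewrite lexx ltW// ell00 => /(_ isT) h1.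
  have := gM (r (- K)); rewrite r1 (le_trans (ltW e0) re) => /(_ isT).
  rewrite /D (ell_shift p (- K) 0 b (r _)) => h2.
  have : K * eps <= K * r (- K) by rewrite ler_wpM2l.
  by lra.
have DP : D K <= 0.
  have [/andP[l0 le] _] := lP K; have [_ rM] := rP K.
  have := rM 1; rewrite lexx ltW// ell1E => /(_ isT) h1.
  have := gM (l K); rewrite l0 (le_trans le (ltW e1)) => /(_ isT).
  rewrite /D (ell_shift p K 0 b (l _)) => h2.
  have : K * l K <= K * eps by rewrite ler_wpM2l.
  by lra.
have [|||a _ Da] := @IVT R D (- K) K 0.
- by rewrite ge0_cp.
- exact/continuous_subspaceT/D_cont.
- by rewrite ge_min DP orbT le_max DN.
have lr : ell p a b (l a) = ell p a b (r a) by apply/eqP; rewrite -subr_eq0; apply/eqP.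
have [/andP[l0 le] lM] := lP a; have [/andP[re r1] rM] := rP a.
have aM t : 0 <= t <= 1 -> ell p a b t <= ell p a b (l a).
  case/andP=> t0 t1; have [te|te] := leP t eps.
    by apply: lM; rewrite t0.
  by rewrite lr; apply: rM; rewrite t1 ltW.
exists a, (l a), (r a); split => //; split.
- by rewrite in_itv/= l0 (le_trans le)// ltW.
- by move=> t; rewrite in_itv/=; exact: aM.
- by rewrite in_itv/= r1 (le_trans _ re)// ltW.
- by rewrite -lr => t; rewrite in_itv/=; exact: aM.
Unshelve. all: by end_near. Qed.

(** Once [eps] is a maximizer, the others cannot lie on both sides of it, since that would make
    three. *)
Lemma maximizers_one_sided p b eps : (2 <= p)%N -> 0 <= b -> 0 < eps < 1 ->
  ~ U_region p (eps, b) -> exists a, maximizers p a b eps /\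
    ((forall x, maximizers p a b x -> eps <= x) \/
     (forall x, maximizers p a b x -> x <= eps)).
Proof.
move=> p2 b0 eI nU; have p0 := ltnW p2.
have [a [x [y [mx my xe ey]]]] := maximizers_straddle p0 b0 eI.
have me : maximizers p a b eps.
  move: xe; rewrite le_eqVlt => /predU1P[<-//|xe].
  move: ey; rewrite le_eqVlt => /predU1P[->//|ey].
  (* Here [eps] lies strictly between x and y. These are all the maximizers, as a third one is
     impossible, so they witness membership in [U_region]. *)
  exfalso; apply: nU; have xy := lt_trans xe ey; split => /=.
    exact: maximizers_b_c mx my xy.
  exists a, x, y; rewrite xe ey xy; split => //.
  - exact: maximizer_gt0 mx.
  - exact: maximizer_lt1 my.
  - apply/seteqP; split => [z mz|z [->|->]//] /=.
    have [zx|xz|] := ltgtP z x; last by left.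
      by case: (maximizers_no3 p2 b0 mz mx my).
    have [zy|yz|] := ltgtP z y; last by right.
      by case: (maximizers_no3 p2 b0 mx mz my).
    by case: (maximizers_no3 p2 b0 mx my mz).
exists a; split => //.
have [[z [mz ze]]|nz] := pselect (exists z, maximizers p a b z /\ z < eps).
  right => w mw; rewrite leNgt; apply/negP => ew.
  exact: maximizers_no3 mz me mw ze ew.
left => w mw; rewrite leNgt; apply/negP => we.
by apply: nz; exists w.
Qed.

End ell_maximizers.

(** * Integrals over the unit cube and their one- and two-coordinate marginals *)

Section unit_cube_integrals.
Context {R : realType}.
Local Notation mR := (measurableTypeR R).
Local Notation mu := (@lebesgue_measure R).
Local Open Scope ereal_scope.

Lemma measurable_unit_square : measurable (@unit_square R).
Proof. by apply: measurableX; exact: measurable_itv. Qed.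

Lemma measurable_unit_cube n : measurable (@unit_cube R n).
Proof.
rewrite (_ : @unit_cube R n = \bigcap_(i : 'I_n) ((@tnth _ mR)^~ i @^-1` `[0%R, 1%R])).
  apply: fin_bigcap_measurable => // i _; rewrite -[X in measurable X]setTI.
  by apply: measurable_tnth => //; exact: measurable_itv.
by apply/seteqP; split=> [u h i _|u h i]; [exact: h|exact: h].
Qed.

Lemma lebesgue_measure_unit_itv : mu `[0%R, 1%R]%classic = 1.
Proof. by rewrite lebesgue_measure_itv/= lte_fin ltr01 sube0. Qed.

Lemma lebesgue2_unit_square : lebesgue2 (@unit_square R) = 1.
Proof.
rewrite /lebesgue2/= product_measure1E; try exact: measurable_itv.
by rewrite -[LHS]/(mu _ * mu _) lebesgue_measure_unit_itv mule1.
Qed.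

Lemma ge0_integral_unit_square (F : mR * mR -> \bar R) :
  measurable_fun setT F -> (forall z, 0 <= F z) ->
  \int[lebesgue2]_(z in unit_square) F z =
  \int[mu]_(x in `[0%R, 1%R]) \int[mu]_(y in `[0%R, 1%R]) F (x, y).
Proof.
move=> mF F0; rewrite integral_mkcond /lebesgue2 fubini_tonelli1.
- rewrite [RHS]integral_mkcond; apply: eq_integral => x _.
  rewrite /fubini_F patchE; case: ifPn => x01.
    rewrite [RHS]integral_mkcond; apply: eq_integral => y _.
    rewrite !patchE; congr (if _ then _ else _).
    by rewrite in_setX x01.
  rewrite integral0_eq// => y _; rewrite patchE in_setX (negPf x01)//.
- apply/(measurable_restrictT _ measurable_unit_square).
  exact: measurable_funTS.
- by move=> z; rewrite patchE; case: ifP.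
Qed.

(** [lebesgue_tuple] at n + 1 is a pushforward of a product along [tuple_cons], so a change of
    variables and Tonelli split off the first coordinate. Extending by zero outside the cube turns
    everything into integrals over full spaces. *)
Lemma ge0_integral_unit_cubeS n (G : n.+1.-tuple mR -> \bar R) :
  measurable_fun setT G -> (forall u, 0 <= G u) ->
  \int[lebesgue_tuple R n.+1]_(u in @unit_cube R n.+1) G u =
  \int[mu]_(x in `[0%R, 1%R])
    \int[lebesgue_tuple R n]_(t in @unit_cube R n) G (tuple_cons (x, t)).
Proof.
move=> mG G0.
have mG' : measurable_fun setT (G \_ (@unit_cube R n.+1)).
  apply: (iffLR (measurable_restrictT G (@measurable_unit_cube n.+1))).
  exact: measurable_funTS mG.
have G'0 u : 0 <= (G \_ (@unit_cube R n.+1)) u by rewrite patchE; case: ifP.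
rewrite integral_mkcond.
have E := @ge0_integral_pushforward _ _ _ _ R _ (@measurable_tuple_cons R n)
  (mu \x lebesgue_tuple R n) setT _ measurableT mG' (fun u _ => G'0 u).
have -> : \int[lebesgue_tuple R n.+1]_u (G \_ (@unit_cube R n.+1)) u =
    \int[mu \x lebesgue_tuple R n]_z
      ((G \_ (@unit_cube R n.+1)) \o @tuple_cons R n) z.
  rewrite preimage_setT in E; rewrite -[RHS]E.
  apply: eq_measure_integral => [|mc A mA _ //].
  exact: measurable_tuple_cons.
rewrite fubini_tonelli1/=; last 2 first.
- by apply: measurableT_comp => //; exact: measurable_tuple_cons.
- by move=> z; exact: G'0.
rewrite [RHS]integral_mkcond; apply: eq_integral => x _.
rewrite /fubini_F patchE; case: ifPn => x01.
  rewrite [RHS]integral_mkcond; apply: eq_integral => t _.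
  rewrite /= !patchE; congr (if _ then _ else _).
  (* As x is in [0, 1], the extended tuple lies in its cube exactly when t does. *)
  apply/idP/idP; rewrite !inE => h i.
    by have := h (lift ord0 i); rewrite tnthS.
  by case: (unliftP ord0 i) => [j ->|->]; rewrite ?tnthS// tnth0; move: x01; rewrite inE.
rewrite integral0_eq// => t _; rewrite /= patchE ifN//.
apply: contra x01; rewrite !inE => /(_ ord0); by rewrite tnth0.
Qed.

Lemma integral_unit_itv_cst (c : \bar R) :
  \int[mu]_(x in `[0%R, 1%R]) c = c.
Proof.
have mI : measurable (`[0%R, 1%R]%classic : set mR) by exact: measurable_itv.
rewrite -[RHS]mule1 -lebesgue_measure_unit_itv.
exact: integral_cst.
Qed.

Lemma lebesgue_tuple_unit_cube n : lebesgue_tuple R n (@unit_cube R n) = 1.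
Proof.
rewrite -[LHS]mul1e -integral_cst; last exact: measurable_unit_cube.
elim: n => [|n IHn].
  rewrite integral_cst ?mul1e; last exact: measurable_unit_cube.
  by rewrite /= diracE mem_set// => -[].
rewrite ge0_integral_unit_cubeS; last 2 first.
- exact: measurable_cst.
- by move=> u; rewrite lee01.
under eq_integral do rewrite IHn.
exact: integral_unit_itv_cst.
Qed.

Lemma integral_unit_cube_cst n (c : \bar R) :
  \int[lebesgue_tuple R n]_(u in @unit_cube R n) c = c.
Proof.
rewrite -[RHS]mule1 -(lebesgue_tuple_unit_cube n).
by apply: integral_cst; exact: measurable_unit_cube.
Qed.

Lemma measurable_tnth_pair n (i j : 'I_n) :
  measurable_fun setT (fun u : n.-tuple mR => (tnth u i, tnth u j)).
Proof. by apply/measurable_fun_pair; exact: measurable_tnth. Qed.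

Lemma integral_unit_cube_tnth n (i : 'I_n) (f : mR -> \bar R) :
  measurable_fun setT f -> (forall x, 0 <= f x) ->
  \int[lebesgue_tuple R n]_(u in @unit_cube R n) f (tnth u i) =
  \int[mu]_(x in `[0%R, 1%R]) f x.
Proof.
move=> mf f0; elim: n => [|n IHn] in i *; first by case: i.
rewrite (ge0_integral_unit_cubeS (G := fun u => f (tnth u i)))//; last first.
  by apply: measurableT_comp => //; exact: measurable_tnth.
case: (unliftP ord0 i) => [j ->|->].
  under eq_integral do under eq_integral do rewrite tnthS.
  under eq_integral do rewrite IHn.
  by rewrite integral_unit_itv_cst.
apply: eq_integral => x _.
rewrite -[RHS](@integral_unit_cube_cst n).
by apply: eq_integral => t _; rewrite tnth0.
Qed.

(** Induction on n, splitting off the first coordinate. As i < j, the index j is never the first: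
    either neither index is first and the induction hypothesis applies, or i is first and the
    one-coordinate marginal handles j. *)
Lemma integral_unit_cube_pair n (i j : 'I_n) (F : mR * mR -> \bar R) :
  (i < j)%N -> measurable_fun setT F -> (forall z, 0 <= F z) ->
  \int[lebesgue_tuple R n]_(u in @unit_cube R n) F (tnth u i, tnth u j) =
  \int[lebesgue2]_(z in unit_square) F z.
Proof.
move=> ij mF F0; elim: n => [|n IHn] in i j ij *; first by case: i ij.
rewrite (ge0_integral_unit_cubeS (G := fun u => F (tnth u i, tnth u j)))//; last first.
  by apply: (measurableT_comp mF); exact: measurable_tnth_pair.
case: (unliftP ord0 j) ij => [j' ->|->//] ij.
case: (unliftP ord0 i) ij => [i' ->|->] ij.
  under eq_integral do under eq_integral do rewrite !tnthS.
  under eq_integral do rewrite IHn//.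
  by rewrite integral_unit_itv_cst.
rewrite ge0_integral_unit_square//; apply: eq_integral => x _.
under eq_integral do rewrite tnth0 tnthS/=.
rewrite (integral_unit_cube_tnth j' (f := fun y => F (x, y)))//.
by apply: measurableT_comp => //; exact: measurable_pair1.
Qed.

End unit_cube_integrals.

(** The function agrees a.e. with its absolute value, whose integral is then 0. This is applied both
    to the gap below the maximum of [ell] and to the signed deviation of h from its mean. *)
Lemma ae_eq0_of_ge0_Rintegral_le0 d (T : measurableType d) (R : realType)
    (mu : {measure set T -> \bar R}) (D : set T) (f : T -> R) : measurable D ->
  mu.-integrable D (EFin \o f) ->
  {ae mu, forall z, D z -> 0 <= f z} -> \int[mu]_(z in D) f z <= 0 ->
  {ae mu, forall z, D z -> f z = 0}.
Proof.
move=> mD intf f0 If; have mf := measurable_int _ intf.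
have mf' : measurable_fun D (fun z => `|(EFin \o f) z|)%E.
  exact: measurableT_comp.
have E : (\int[mu]_(z in D) `|(EFin \o f) z| = \int[mu]_(z in D) (EFin \o f) z)%E.
  apply: ae_eq_integral => //.
  by apply: filterS f0 => z + Dz => /(_ Dz) fz; rewrite /= ger0_norm.
have I0 : (\int[mu]_(z in D) `|(EFin \o f) z| = 0)%E.
  apply/eqP; rewrite eq_le integral_ge0 ?andbT; last by move=> z _; exact: abse_ge0.
  rewrite E -(fineK (integrable_fin_num mD intf)) lee_fin; exact: If.
have /ae_eq_integral_abs -/(_ mD mf) := I0.
by apply: filterS => z h Dz; have [] := h Dz.
Qed.

(** * Integral functionals of graphons *)

Section graphon_integrals.
Context {R : realType}.
Local Notation mR := (measurableTypeR R).
Implicit Types (h : mR * mR -> R) (phi : R -> R).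

Lemma continuous_I_fun : continuous (@I_fun R).
Proof.
move=> x; apply: cvgD; first exact: continuous_xlnx.
have h : (1 - y) @[y --> x] --> 1 - x.
  by apply: cvgB; [exact: cvg_cst|exact: cvg_id].
exact: (cvg_comp _ _ h (@continuous_xlnx _ (1 - x))).
Qed.

(** A continuous function is bounded on [0, 1], where h takes its values, and the square has measure
    1. *)
Lemma integrable_comp_graphon h phi : graphon h -> continuous phi ->
  lebesgue2.-integrable unit_square (EFin \o (phi \o h)).
Proof.
move=> [mh h01 _] cphi; apply: (measurable_bounded_integrable (@measurable_unit_square R)).
- by rewrite lebesgue2_unit_square ltry.
- by apply: measurableT_comp => //; exact: continuous_measurable_fun.
- have [|c _ cM] := @EVT_max R (fun x => `|phi x|) 0 1 ler01.
    apply: continuous_subspaceT => x; apply: cvg_norm; exact: cphi.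
  exists `|phi c|; split; first exact: num_real.
  move=> M cM' z /h01 hz; apply: le_trans (ltW cM'); apply: cM.
  by rewrite in_itv.
Qed.

(** On feasible graphons the first term is constant, so [a] acts as a Lagrange multiplier for the
    constraint on the mean. *)
Lemma integral_graphon_ell h p a b : graphon h ->
  \int[lebesgue2]_(z in unit_square) ell p a b (h z) =
  a * \int[lebesgue2]_(z in unit_square) h z +
  b * \int[lebesgue2]_(z in unit_square) (h z ^+ p) -
  \int[lebesgue2]_(z in unit_square) I_fun (h z).
Proof.
move=> gh; have mS := @measurable_unit_square R.
have i1 : lebesgue2.-integrable unit_square (EFin \o h).
  by apply: (integrable_comp_graphon (phi := id) gh) => x; exact: cvg_id.
have ip : lebesgue2.-integrable unit_square (EFin \o (fun z => h z ^+ p)).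
  apply: (integrable_comp_graphon (phi := fun x => x ^+ p) gh).
  exact: exprn_continuous.
have iI := integrable_comp_graphon gh continuous_I_fun.
have ca (c : R) (phi : R -> R) : continuous phi -> continuous (fun x => c * phi x).
  by move=> cphi x; apply: cvgMr; exact: cphi.
have i1' : lebesgue2.-integrable unit_square (EFin \o (fun z => a * h z)).
  apply: (integrable_comp_graphon (phi := fun x => a * x) gh).
  by apply: ca => x; exact: cvg_id.
have ip' : lebesgue2.-integrable unit_square (EFin \o (fun z => b * h z ^+ p)).
  apply: (integrable_comp_graphon (phi := fun x => b * x ^+ p) gh).
  by apply: ca; exact: exprn_continuous.
rewrite -RintegralZl// -[in RHS]RintegralZl// -RintegralD// -RintegralB//.
  by apply: eq_Rintegral => z _; rewrite /ell /I_fun; ring.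
apply: (integrable_comp_graphon (phi := fun x => a * x + b * x ^+ p) gh) => x.
by apply: cvgD; apply: cvgMr; [exact: cvg_id|exact: exprn_continuous].
Qed.

(** AM-GM bounds the product over the p edges by the average of the p-th powers of its factors. Each
    factor sees only two coordinates, so all p averaged terms have the same integral. *)
Lemma hom_density_le n (H : rel 'I_n) h : graphon h -> (0 < #|edges H|)%N ->
  hom_density H h <= \int[lebesgue2]_(z in unit_square) (h z ^+ #|edges H|).
Proof.
set p := #|edges H| => gh p0; have mS := @measurable_unit_square R.
have [mh h01 _] := gh.
(* The extension by zero is measurable and nonnegative everywhere, as the marginal lemmas
   require. *)
pose g := h \_ (@unit_square R).
have gE z : unit_square z -> g z = h z by move=> zS; rewrite /g patchE mem_set.
have g0 z : 0 <= g z.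
  by rewrite /g patchE; case: ifPn => // /set_mem/h01/andP[].
have mg : measurable_fun setT g by exact/(measurable_restrictT _ mS).
have mgp : measurable_fun setT (fun z => (g z ^+ p)%:E).
  by apply/measurable_EFinP; exact: measurable_funX.
have cube_square n' (u : n'.-tuple mR) i j :
    unit_cube u -> unit_square (tnth u i, tnth u j).
  by move=> hu; split; [exact: (hu i)|exact: (hu j)].
have mpair (i j : 'I_n) (f : mR * mR -> \bar R) : measurable_fun setT f ->
    measurable_fun (@unit_cube R n) (fun u => f (tnth u i, tnth u j)).
  move=> mf; apply: measurable_funTS; apply: (measurableT_comp mf).
  exact: measurable_tnth_pair.
have ip : lebesgue2.-integrable unit_square (EFin \o (fun z => h z ^+ p)).
  apply: (integrable_comp_graphon (phi := fun x => x ^+ p) gh).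
  exact: exprn_continuous.
have mC := @measurable_unit_cube R n.
have pI : p%:R^-1 * p%:R = 1 :> R by rewrite mulVf// pnatr_eq0 -lt0n.
pose c := p%:R^-1 * \int[lebesgue2]_(z in unit_square) (h z ^+ p).
have EF (ij : 'I_n * 'I_n) : ij \in edges H ->
    (\int[lebesgue_tuple R n]_(u in @unit_cube R n)
      (p%:R^-1 * g (tnth u ij.1, tnth u ij.2) ^+ p)%:E = c%:E)%E.
  rewrite inE => /andP[ij12 _].
  rewrite (integral_unit_cube_pair (F := fun z => (p%:R^-1 * g z ^+ p)%:E))//.
  - rewrite /c -RintegralZl// /Rintegral fineK; last first.
      apply: integrable_fin_num => //.
      apply: (integrable_comp_graphon (phi := fun x => p%:R^-1 * x ^+ p) gh) => x.
      by apply: cvgMr; exact: exprn_continuous.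
    by apply: eq_integral => z /set_mem zS; rewrite gE.
  - by apply/measurable_EFinP; apply: measurable_funM => //; exact: measurable_funX.
  - by move=> z; rewrite lee_fin mulr_ge0 ?exprn_ge0.
have mF (ij : 'I_n * 'I_n) : measurable_fun (@unit_cube R n)
    (fun u => (p%:R^-1 * g (tnth u ij.1, tnth u ij.2) ^+ p)%:E).
  apply: (mpair _ _ (fun z => (p%:R^-1 * g z ^+ p)%:E)).
  by apply/measurable_EFinP; apply: measurable_funM => //; exact: measurable_funX.
have le_c : (\int[lebesgue_tuple R n]_(u in @unit_cube R n)
      (\prod_(ij in edges H) h (tnth u ij.1, tnth u ij.2))%:E <= (c *+ p)%:E)%E.
  have -> : ((c *+ p)%:E = \int[lebesgue_tuple R n]_(u in @unit_cube R n)
      \sum_(ij <- enum (edges H)) (p%:R^-1 * g (tnth u ij.1, tnth u ij.2) ^+ p)%:E)%E.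
    rewrite ge0_integral_sum//.
    - rewrite big_enum/= (eq_bigr (fun=> c%:E)) => [|ij]; last exact: EF.
      by rewrite sumEFin sumr_const.
    - by move=> ij u _; rewrite lee_fin mulr_ge0 ?exprn_ge0.
  rewrite (eq_integral (fun u => (\prod_(ij <- enum (edges H))
      g (tnth u ij.1, tnth u ij.2))%:E)); last first.
    move=> u /set_mem uC; rewrite big_enum; congr EFin; apply: eq_bigr => ij _.
    by rewrite gE//; exact: cube_square.
  apply: ge0_le_integral => //.
  - by move=> u _; rewrite lee_fin prodr_ge0.
  - by apply/measurable_EFinP; apply: measurable_prod => ij _;
      apply/measurable_EFinP; apply: (mpair _ _ (fun z => (g z)%:E));
      apply/measurable_EFinP.
  - by apply: emeasurable_sum => ij; exact: mF.
  - move=> u _; rewrite sumEFin lee_fin !big_enum/= -mulr_sumr mulrC.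
    (* AM-GM for the p-th powers compares the p-th power of the product with the p-th power of the
       average; taking p-th roots gives the bound. *)
    have AG := leif_AGM (A := mem (edges H))
      (E := fun ij => g (tnth u ij.1, tnth u ij.2) ^+ p) (fun ij _ => exprn_ge0 p (g0 _)).
    have {AG} := AG.1; rewrite prodrXl -/p => AG.
    by rewrite -(ler_pXn2r p0)// nnegrE ?prodr_ge0// mulr_ge0// sumr_ge0// => ij _;
      rewrite exprn_ge0.
rewrite /hom_density /Rintegral.
have -> : fine (\int[lebesgue2]_(z in unit_square) (h z ^+ p)%:E)%E = fine (c *+ p)%:E.
  by rewrite /= -mulr_natl mulrA [_ * _^-1]mulrC pI mul1r.
have ge0 : (0 <= \int[lebesgue_tuple R n]_(u in @unit_cube R n)
      (\prod_(ij in edges H) h (tnth u ij.1, tnth u ij.2))%:E)%E.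
  apply: integral_ge0 => u uC; rewrite lee_fin prodr_ge0// => ij _.
  by case: (andP (h01 _ (cube_square _ u ij.1 ij.2 uC))).
apply: fine_le => //; rewrite ge0_fin_numE//.
exact: le_lt_trans le_c (ltry _).
Qed.

Lemma hom_density_cst n (H : rel 'I_n) (c : R) :
  hom_density H (fun=> c) = c ^+ #|edges H|.
Proof.
rewrite /hom_density /Rintegral (eq_integral (fun=> (c ^+ #|edges H|)%:E)).
  by rewrite integral_unit_cube_cst.
by move=> u _; rewrite prodr_const.
Qed.

Lemma Rintegral_unit_square_cst (c : R) :
  \int[lebesgue2]_(z in @unit_square R) c = c.
Proof.
have /(congr1 fine) := integral_cst (@lebesgue2 R) (@measurable_unit_square R) c%:E.
by rewrite lebesgue2_unit_square mule1.
Qed.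

Lemma objective_cst n (H : rel 'I_n) (beta c : R) :
  objective H beta (fun=> c) = beta * c ^+ #|edges H| - 2^-1 * I_fun c.
Proof. by rewrite /objective hom_density_cst Rintegral_unit_square_cst. Qed.

Lemma feasible_cst (c : R) : 0 <= c <= 1 -> feasible c (fun=> c).
Proof.
move=> c01; split; last exact: Rintegral_unit_square_cst.
by split => //; exact: measurable_cst.
Qed.

(** [s] encodes the side: 1 when h >= [eps] a.e., -1 when h <= [eps] a.e. The mean constraint makes
    the integral of s (h - eps) zero, so this nonnegative function vanishes a.e. *)
Lemma feasible_ae_uniform (s eps : R) h : s != 0 -> feasible eps h ->
  {ae lebesgue2, forall z, unit_square z -> 0 <= s * (h z - eps)} -> uniform h.
Proof.
move=> s0 [gh Ih] heps; exists eps.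
have mS := @measurable_unit_square R.
have i1 : lebesgue2.-integrable unit_square (EFin \o h).
  by apply: (integrable_comp_graphon (phi := id) gh) => x; exact: cvg_id.
have ie : lebesgue2.-integrable unit_square (EFin \o (fun=> eps)).
  by apply: (integrable_comp_graphon (phi := fun=> eps) gh) => x; exact: cvg_cst.
have cB : continuous (fun x : R => x - eps).
  by move=> x; apply: cvgB; [exact: cvg_id|exact: cvg_cst].
have : {ae lebesgue2, forall z, unit_square z -> s * (h z - eps) = 0}.
  apply: ae_eq0_of_ge0_Rintegral_le0 => //.
    apply: (integrable_comp_graphon (phi := fun x => s * (x - eps)) gh) => x.
    by apply: cvgMr; exact: cB.
  rewrite RintegralZl//; last exact: (integrable_comp_graphon gh cB).
  by rewrite RintegralB// Rintegral_unit_square_cst Ih subrr mulr0.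
apply: filterS => z hz /hz/eqP.
by rewrite mulf_eq0 (negPf s0) subr_eq0 => /eqP.
Qed.

End graphon_integrals.

(** * From maximizers of [ell] to optimizing graphons *)

Theorem proposition5 (R : realType) (n : nat) (H : rel 'I_n)
    (Hsym : symmetric H) (Hirr : irreflexive H) (p : nat)
    (Hp : p = #|edges H|) (Hp2 : (2 <= p)%N)
    (eps beta2 : R) (Heps : 0 <= eps <= 1) (Hbeta : 0 <= beta2)
    (HU : ~ U_region p (eps, 2 * beta2)) (h : R * R -> R) :
  optimizing H eps beta2 h -> uniform h.
Proof.
move=> [fh hmax]; have [gh Ih] := fh; have [mh h01 _] := gh.
(* For [eps] equal to 0 or 1, the bounds 0 <= h <= 1 and the mean already force h to be constant
   a.e. *)
have [e0|e0] := leP eps 0.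
  apply: (feasible_ae_uniform (s := 1) _ fh); rewrite ?oner_eq0//.
  apply: aeW => z /h01/andP[hz _].
  by rewrite mul1r subr_ge0 (le_trans e0).
have [e1|e1] := leP 1 eps.
  apply: (feasible_ae_uniform (s := -1) _ fh); rewrite ?oppr_eq0 ?oner_eq0//.
  apply: aeW => z /h01/andP[_ hz].
  by rewrite mulN1r oppr_ge0 subr_le0 (le_trans hz).
have mS := @measurable_unit_square R.
have b0 : 0 <= 2 * beta2 by rewrite mulr_ge0.
have [|a [me side]] := maximizers_one_sided Hp2 b0 _ HU; first by rewrite e0.
have ae_max : {ae lebesgue2, forall z, unit_square z -> maximizers p a (2 * beta2) (h z)}.
  pose f z := ell p a (2 * beta2) eps - ell p a (2 * beta2) (h z).
  have cf : continuous (fun x => ell p a (2 * beta2) eps - ell p a (2 * beta2) x).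
    by move=> x; apply: cvgB; [exact: cvg_cst|exact: continuous_ell].
  have ie : lebesgue2.-integrable unit_square (EFin \o (fun=> ell p a (2 * beta2) eps)).
    by apply: (integrable_comp_graphon (phi := fun=> _) gh) => x; exact: cvg_cst.
  have il := integrable_comp_graphon gh (@continuous_ell _ p a (2 * beta2)).
  have If : \int[lebesgue2]_(z in unit_square) f z <= 0.
    rewrite RintegralB//.
    rewrite Rintegral_unit_square_cst subr_le0 integral_graphon_ell// Ih.
    (* Twice the objective plus a [eps] equals [ell] at [eps] for the constant graphon, and by [hd]
       is at most the integral of [ell] along h. Optimality of h then compares the two. *)
    have : ((objective H beta2 (fun=> eps))%:E <= (objective H beta2 h)%:E)%E.
      rewrite hmax; apply: ereal_sup_ubound; exists (fun=> eps) => //.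
      exact: feasible_cst.
    rewrite lee_fin objective_cst /objective -Hp.
    have hd : hom_density H h <= \int[lebesgue2]_(z in unit_square) (h z ^+ p).
      by rewrite Hp; apply: hom_density_le; rewrite // -Hp ltnW.
    have := ler_wpM2l Hbeta hd.
    rewrite /ell /I_fun; lra.
  have : {ae lebesgue2, forall z, unit_square z -> f z = 0}.
    apply: ae_eq0_of_ge0_Rintegral_le0 => //.
      exact: (integrable_comp_graphon gh cf).
    apply: aeW => z /h01 hz; rewrite subr_ge0; apply: me.2.
    by rewrite in_itv.
  apply: filterS => z f0 zS; split; first by rewrite in_itv; exact: h01.
  have -> : ell p a (2 * beta2) (h z) = ell p a (2 * beta2) eps.
    by apply/esym/eqP; rewrite -subr_eq0; apply/eqP; exact: f0.
  exact: me.2.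
case: side => side.
- apply: (feasible_ae_uniform (s := 1) _ fh); rewrite ?oner_eq0//.
  by apply: filterS ae_max => z mz zS; rewrite mul1r subr_ge0; apply/side/mz.
- apply: (feasible_ae_uniform (s := -1) _ fh); rewrite ?oppr_eq0 ?oner_eq0//.
  by apply: filterS ae_max => z mz zS; rewrite mulN1r oppr_ge0 subr_le0; apply/side/mz.
Qed.
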